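(* Let $K^*\in\mathbb{N}$, $M>0$, $p\in\mathbb{N}$, let $\mathcal{Y}\subset\mathbb{R}^{K^*}$ be a closed set, let $f_*:[-M,M]^p\to\mathcal{Y}$ be continuous, and let $g_*:\mathcal{Y}^2\to\mathbb{R}$ be a conditionally positive definite kernel. Let $\sigma:\mathbb{R}\to\mathbb{R}$ be either the ReLU function or a function that is non-constant, continuous, bounded and monotonically increasing. Then for every $\varepsilon>0$, for sufficiently large $K\in\mathbb{N}$, $T=T(K)\in\mathbb{N}$ and $T'\in\mathbb{N}$, there exist $\boldsymbol A\in\mathbb{R}^{K\times T}$, $\boldsymbol B\in\mathbb{R}^{T\times p}$, $\boldsymbol c\in\mathbb{R}^T$, $\boldsymbol e\in\mathbb{R}^{T'}$, $\boldsymbol F\in\mathbb{R}^{T'\times p}$, $\boldsymbol o\in\mathbb{R}^{T'}$ such that \[ \Big| g_*\big(f_*(\boldsymbol x),f_*(\boldsymbol x')\big) - \big( \langle f_{\boldsymbol\psi}(\boldsymbol x), f_{\boldsymbol\psi}(\boldsymbol x')\rangle + u_{\boldsymbol\xi}(\boldsymbol x) + u_{\boldsymbol\xi}(\boldsymbol x')\big)\Big| < \varepsilon \] for all $(\boldsymbol x,\boldsymbol x')\in[-M,M]^{2p}$, where $f_{\boldsymbol\psi}(\boldsymbol x)=\boldsymbol A\,\boldsymbol\sigma(\boldsymbol B\boldsymbol x+\boldsymbol c)\in\mathbb{R}^K$ and $u_{\boldsymbol\xi}(\boldsymbol x)=\langle \boldsymbol e,\boldsymbol\sigma(\boldsymbol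 F\boldsymbol x+\boldsymbol o)\rangle\in\mathbb{R}$, and $\boldsymbol\sigma$ denotes $\sigma$ applied element-wise.
   Context: A kernel on $\mathcal{Y}^2$ is a symmetric continuous function $g:\mathcal{Y}^2\to\mathbb{R}$. A kernel $g$ is conditionally positive definite (CPD) if $\sum_{i=1}^n\sum_{j=1}^n c_ic_j g(\boldsymbol y_i,\boldsymbol y_j)\ge 0$ for all $n\in\mathbb{N}$, all $\boldsymbol y_1,\dots,\boldsymbol y_n\in\mathcal{Y}$ and all $c_1,\dots,c_n\in\mathbb{R}$ with $\sum_{i=1}^n c_i=0$. $\langle\cdot,\cdot\rangle$ is the Euclidean inner product. *)

(* Defs.v *)
From HB Require Import structures.
From mathcomp Require Import all_boot all_order all_algebra.
From mathcomp Require Import all_classical all_reals all_analysis.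
Set Implicit Arguments. Unset Strict Implicit. Unset Printing Implicit Defensive.
Import Order.TTheory GRing.Theory Num.Theory.
Import numFieldNormedType.Exports.
Local Open Scope classical_set_scope.
Local Open Scope ring_scope.

Definition inner (R : ringType) (n : nat) (u v : 'cV[R]_n) : R :=
  \sum_(i < n) u i 0 * v i 0.

Definition vsigma (R : Type) (n : nat) (sigma : R -> R) (v : 'cV[R]_n) : 'cV[R]_n :=
  map_mx sigma v.

Definition cube (R : realType) (p : nat) (M : R) : set 'cV[R]_p :=
  [set x | forall i, - M <= x i 0 <= M].

Arguments cube : clear implicits.
Arguments cube {R}.

Definition relu (R : realType) (x : R) : R := Num.max x 0.

Definition admissible_activation (R : realType) (sigma : R -> R) : Prop :=
  sigma = @relu R \/
  [/\ (exists a b : R, sigma a != sigma b),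
      continuous sigma,
      (exists C : R, forall x, `|sigma x| <= C) &
      (forall x y : R, x <= y -> sigma x <= sigma y)].

Definition is_kernel (R : realType) (n : nat) (Y : set 'cV[R]_n)
    (g : 'cV[R]_n -> 'cV[R]_n -> R) : Prop :=
  (forall y y', Y y -> Y y' -> g y y' = g y' y) /\
  {within [set z | Y z.1 /\ Y z.2], continuous (fun z => g z.1 z.2)}.

Definition is_CPD (R : realType) (n : nat) (Y : set 'cV[R]_n)
    (g : 'cV[R]_n -> 'cV[R]_n -> R) : Prop :=
  forall (m : nat) (y : 'I_m -> 'cV[R]_n) (c : 'I_m -> R),
    (forall i, Y (y i)) -> \sum_(i < m) c i = 0 ->
    0 <= \sum_(i < m) \sum_(j < m) c i * c j * g (y i) (y j).

(* Main.v *)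
(* Fixing a base point y0, g(y,y') = G(y,y') + v(y) + v(y') with G positive
   semidefinite and v(y) = g(y,y0) - g(y0,y0)/2. Mercer's theorem is avoided by
   discretizing first: with tensor Bernstein weights w_k(x) >= 0, sum_k w_k = 1,
   taken in the coordinates exp(x_i) rescaled to [0,1], the kernel
   g(f(x),f(x')) is uniformly close to sum_(k,l) w_k(x) w_l(x') g(f(y_k),f(y_l)),
   which only involves a finite Gram matrix. Its positive semidefinite part
   factors as B B^T, so the features are phi_i = sum_k B_(k,i) w_k.
   The choice of coordinates makes each w_k a linear combination of functions
   x |-> exp <a,x>, and on a bounded interval exp is a uniform limit of
   staircases sum_j c_j s(lambda t + m_j) for every nonconstant bounded monotone s.
   ReLU reduces to this case through s(t) = relu(t+1) - relu(t). *)

Require Import Defs.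
From HB Require Import structures.
From mathcomp Require Import all_boot all_order all_algebra.
From mathcomp Require Import all_classical all_reals all_analysis.
From mathcomp Require Import ring lra.
Set Implicit Arguments. Unset Strict Implicit. Unset Printing Implicit Defensive.
Import Order.TTheory GRing.Theory Num.Theory.
Import numFieldNormedType.Exports.
Local Open Scope classical_set_scope.
Local Open Scope ring_scope.

(** * Positive semidefinite factorization *)

(** Cholesky by induction on the size: split off the first row and column and recurse on the Schur
    complement of the pivot [a]. As [0^-1 = 0], the same formulas serve a zero pivot, where
    positivity forces the rest of its row to vanish. *)
Lemma psd_factor (R : rcfType) (n : nat) (G : 'M[R]_n) :
  G^T = G -> (forall v : 'cV[R]_n, 0 <= (v^T *m G *m v) 0 0) ->
  exists B : 'M[R]_n, G = B *m B^T.
Proof.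
elim: n G => [|n IHn] G Gsym Gpos.
  by exists 0; apply/matrixP => -[].
change 'M[R]_(1 + n) in G.
have {}Gsym : G^T = G := Gsym.
have {}Gpos (v : 'cV[R]_(1 + n)) : 0 <= (v^T *m G *m v) 0 0 := Gpos v.
pose a := ulsubmx G 0 0; pose r := ursubmx G; pose D := drsubmx G.
have GE : G = block_mx a%:M r r^T D.
  rewrite -[LHS]submxK -mx11_scalar; congr block_mx.
  by rewrite -[in LHS]Gsym trmx_ursub.
have Dsym : D^T = D by rewrite /D trmx_drsub Gsym.
have quadE t (v : 'cV[R]_n) :
    0 <= t ^+ 2 * a + 2 * t * (r *m v) 0 0 + (v^T *m D *m v) 0 0.
  have := Gpos (col_mx t%:M v).
  rewrite GE tr_col_mx tr_scalar_mx mul_row_block mul_row_col !mulmxDl.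
  rewrite !mul_scalar_mx -!scalemxAl !mul_mx_scalar.
  have -> : v^T *m r^T = (r *m v)^T by rewrite trmx_mul.
  by rewrite !mxE /= mulr1n; congr (0 <= _); ring.
have sub11 (P Q : 'M[R]_1) c : (P - c *: Q) 0 0 = P 0 0 - c * Q 0 0.
  by rewrite !mxE.
have sq11 (w : 'M[R]_1) : (w^T *m w) 0 0 = w 0 0 ^+ 2.
  by rewrite mxE big_ord1 mxE expr2.
have a_ge0 : 0 <= a.
  have := quadE 1 0.
  by rewrite !mulmx0 !mxE expr1n mul1r mulr0 !addr0.
have r0 : a = 0 -> r = 0.
  move=> a0; apply/rowP => j; rewrite [RHS]mxE.
  have := quadE _ (delta_mx j 0); rewrite -colE mxE a0.
  set q := (_ *m _) 0 0; move=> Q; apply/eqP; apply: contraT => rj0.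
  (* With [a = 0] the form is affine in [t] with slope [2 * r 0 j]; this [t] would give it the value
     [-1]. *)
  have := Q (- (1 + q) / (2 * r 0 j)).
  have -> : 2 * (- (1 + q) / (2 * r 0 j)) * r 0 j = - (1 + q) by field.
  by rewrite mulr0 add0r opprD addrNK oppr_ge0 lt_geF.
have [|v|B1 HB1] := IHn (D - a^-1 *: (r^T *m r)).
- by rewrite linearB /= linearZ /= trmx_mul trmxK Dsym.
- have -> : (v^T *m (D - a^-1 *: (r^T *m r)) *m v) 0 0 =
     (v^T *m D *m v) 0 0 - a^-1 * (r *m v) 0 0 ^+ 2.
    rewrite mulmxBr mulmxBl -scalemxAr -scalemxAl (mulmxA v^T).
    rewrite -(mulmxA _ r v) -trmx_mul; set rv := r *m v.
    by rewrite sub11 sq11.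
  have [a0|a0] := eqVneq a 0.
    have := quadE 0 v.
    by rewrite a0 invr0 mul0r subr0 expr2 !mulr0 !mul0r !add0r.
  (* This [t] minimizes the form along the pivot direction, and the minimum is the Schur complement
     evaluated at [v]. *)
  have := quadE (- (r *m v) 0 0 / a) v.
  by congr (0 <= _); field.
have trZ c : (c *: r^T)^T = c *: r by apply/matrixP => i j; rewrite !mxE.
suff [B ->] : exists B : 'M[R]_(1 + n), G = B *m B^T by exists B.
exists (block_mx (Num.sqrt a)%:M 0 ((Num.sqrt a)^-1 *: r^T) B1).
rewrite GE tr_block_mx mulmx_block !raddf0 ?mulmx0 ?mul0mx !addr0.
rewrite tr_scalar_mx trZ -scalar_mxM -expr2 sqr_sqrtr //.
rewrite mul_scalar_mx mul_mx_scalar -HB1 !scalerA -scalemxAl -scalemxAr scalerA.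
rewrite -invfM -expr2 sqr_sqrtr // [_ *: _ + _]addrC subrK.
have [a0|a0] := eqVneq a 0.
  by rewrite r0 // trmx0 !scaler0.
by rewrite divff ?sqrtr_eq0 -?ltNge ?lt_def ?a0 // !scale1r.
Qed.

(** Zero columns widen the factor, so that the feature dimension can be any [K] above the number of
    sample points. *)
Lemma psd_factor_pad (R : rcfType) (n m : nat) (G : 'M[R]_n) :
  (n <= m)%N ->
  G^T = G -> (forall v : 'cV[R]_n, 0 <= (v^T *m G *m v) 0 0) ->
  exists B : 'M[R]_(n, m), G = B *m B^T.
Proof.
move=> le_nm Gsym /(psd_factor Gsym)[B ->].
rewrite -(subnKC le_nm); exists (row_mx B 0).
by rewrite tr_row_mx mul_row_col mul0mx addr0.
Qed.

(** * Bernstein weights *)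

Section Bernstein.
Context {R : numFieldType}.
Implicit Types (t z : R) (n k : nat).

Definition bernstein n t k : R := 'C(n, k)%:R * t ^+ k * (1 - t) ^+ (n - k).

Lemma bernstein_ge0 n t k : 0 <= t <= 1 -> 0 <= bernstein n t k.
Proof.
by case/andP=> t0 t1; rewrite !mulr_ge0 ?exprn_ge0 ?subr_ge0 // ler0n.
Qed.

(** Pascal's rule, read as conditioning a binomial mean on one extra toss with success probability
    [t]. It drives both moment computations by induction on [n]. *)
Lemma bernstein_mean_rec n t (phi : nat -> R) :
  \sum_(k < n.+2) bernstein n.+1 t k * phi k =
  \sum_(k < n.+1) bernstein n t k * (t * phi k.+1 + (1 - t) * phi k).
Proof.
rewrite big_ord_recl /=.
have bS k : (k <= n)%N -> bernstein n.+1 t k.+1 =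
    t * bernstein n t k + (1 - t) * bernstein n t k.+1.
  rewrite /bernstein binS natrD subSS exprS => kn.
  (* At [k = n] the exponent [n - k.+1] is truncated, but there the binomial coefficient
     vanishes. *)
  have [->|kltn] := eqVneq k n.
    by rewrite subnn bin_small // binn !expr0; ring.
  by rewrite -[(n - k)%N]subnSK ?ltn_neqAle ?kltn // [_ ^+ (_.+1)]exprS; ring.
rewrite (eq_bigr (fun k : 'I_n.+1 => t * bernstein n t k * phi k.+1 +
   (1 - t) * bernstein n t k.+1 * phi k.+1)); last first.
  by move=> k _; rewrite /= /bump add1n bS ?mulrDl // -ltnS.
rewrite big_split /= addrCA addrC.
under [in RHS]eq_bigr => k _ do rewrite mulrDr.
rewrite [RHS]big_split /= addrC; congr (_ + _).
  by apply: eq_bigr => k _; ring.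
rewrite [RHS]big_ord_recl big_ord_recr /=; congr (_ + _).
  rewrite /bernstein !bin0 !subn0 exprS; ring.
rewrite [X in _ + X](_ : _ = 0) ?addr0; last first.
  by rewrite /bernstein bin_small // !mul0r mulr0 mul0r.
by apply: eq_bigr => k _; ring.
Qed.

Lemma bernstein_sum1 n t : \sum_(k < n.+1) bernstein n t k = 1.
Proof.
elim: n => [|n IHn].
  by rewrite big_ord1 /bernstein bin0 !expr0 !mulr1.
rewrite -{}IHn; have := bernstein_mean_rec n t (fun=> 1).
under eq_bigr do rewrite mulr1.
by move=> ->; apply: eq_bigr => k _; ring.
Qed.

(* The centre [z] is free so that the shift [k -> k + 1] in the recursion can be
   absorbed by [z -> z - 1]. *)
Lemma bernstein_second_moment n t z :
  \sum_(k < n.+1) bernstein n t k * (k%:R - z) ^+ 2 =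
  n%:R * t * (1 - t) + (n%:R * t - z) ^+ 2.
Proof.
elim: n z => [|n IHn] z.
  by rewrite big_ord1 /bernstein /= bin0 subnn !expr0; ring.
rewrite (bernstein_mean_rec n t (fun k => (k%:R - z) ^+ 2)).
under eq_bigr => k _ do rewrite mulrDr (mulrCA _ t) (mulrCA _ (1 - t)).
rewrite big_split -!big_distrr /=. rewrite IHn.
under eq_bigr => k _ do rewrite -natr1 -addrA -(opprB z).
by rewrite IHn -natr1; ring.
Qed.

Lemma bernstein_variance n t : 0 <= t <= 1 ->
  \sum_(k < n.+2) bernstein n.+1 t k * (t - k%:R / n.+1%:R) ^+ 2 <= n.+1%:R^-1.
Proof.
move=> /andP[t0 t1].
have n0 : n.+1%:R != 0 :> R by rewrite pnatr_eq0.
have -> : \sum_(k < n.+2) bernstein n.+1 t k * (t - k%:R / n.+1%:R) ^+ 2 =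
    n.+1%:R ^- 2 * (\sum_(k < n.+2) bernstein n.+1 t k * (k%:R - n.+1%:R * t) ^+ 2).
  rewrite big_distrr /=; apply: eq_bigr => k _.
  rewrite [RHS]mulrCA; congr (_ * _). field.
  by rewrite nat1r.
rewrite bernstein_second_moment subrr expr0n addr0.
have -> : n.+1%:R ^- 2 * (n.+1%:R * t * (1 - t)) = n.+1%:R^-1 * (t * (1 - t)).
  by field; rewrite nat1r.
rewrite ler_piMr ?invr_ge0 ?ler0n //.
by rewrite mulr_ile1 // ?subr_ge0 // gerBl.
Qed.

End Bernstein.

Section TensorBernstein.
Context {R : numFieldType} {p : nat}.
Implicit Types (t : 'I_p -> R) (n : nat).

Definition mbernstein n t (k : {ffun 'I_p -> 'I_n.+1}) : R :=
  \prod_i bernstein n (t i) (k i).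

Lemma mbernstein_ge0 n t k :
  (forall i, 0 <= t i <= 1) -> 0 <= mbernstein (n := n) t k.
Proof. by move=> t01; apply: prodr_ge0 => i _; apply: bernstein_ge0. Qed.

Lemma mbernstein_sum1 n t : \sum_k mbernstein (n := n) t k = 1.
Proof.
rewrite -(bigA_distr_bigA (fun i (j : 'I_n.+1) => bernstein n (t i) j)) /=.
by apply: big1 => i _; rewrite bernstein_sum1.
Qed.

(** The sum over multi-indices is a product of one-dimensional sums; only factor [i] carries the
    square, and the others sum to 1. *)
Lemma mbernstein_variance n t i : (forall i, 0 <= t i <= 1) ->
  \sum_k mbernstein (n := n.+1) t k * (t i - (k i)%:R / n.+1%:R) ^+ 2
    <= n.+1%:R^-1.
Proof.
move=> t01.
pose F j (l : 'I_n.+2) := bernstein n.+1 (t j) l *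
  (if j == i then (t i - l%:R / n.+1%:R) ^+ 2 else 1).
rewrite (eq_bigr (fun k : {ffun 'I_p -> 'I_n.+2} => \prod_j F j (k j))).
  rewrite -(bigA_distr_bigA F) /= (bigD1 i) //= [X in _ * X]big1 => [|j ji].
    by rewrite mulr1 /F eqxx bernstein_variance.
  rewrite /F (negPf ji).
  by under eq_bigr do rewrite mulr1; rewrite bernstein_sum1.
move=> k _; rewrite /mbernstein (bigD1 i) //= [RHS](bigD1 i) //= /F eqxx mulrAC.
by congr (_ * _); apply: eq_bigr => j /negPf->; rewrite mulr1.
Qed.

End TensorBernstein.

(** * Spans, uniform limits and ridge functions *)

Section Span.
Context {R : numFieldType} {T : Type}.
Implicit Types (S : set (T -> R)) (X : set T).

(** Scalar generators with vector coefficients: for [V] the column vectors, all output coordinates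
    share the same generators, as the outputs of a network share its hidden layer. *)
Inductive span {V : lmodType R} S : (T -> V) -> Prop :=
| span_nil : span S (fun=> 0)
| span_cons s v f : S s -> span S f -> span S (fun x => s x *: v + f x).

Lemma span_add (V : lmodType R) S (f g : T -> V) :
  span S f -> span S g -> span S (fun x => f x + g x).
Proof.
move=> Sf Sg; elim: Sf => [|s v h Ss _ IH].
  by under eq_fun do rewrite add0r.
by under eq_fun do rewrite -addrA; exact: span_cons.
Qed.

Lemma span_linear (V W : lmodType R) (phi : {linear V -> W}) S (f : T -> V) :
  span S f -> span S (fun x => phi (f x)).
Proof.
elim=> [|s v h Ss _ IH]; first by under eq_fun do rewrite linear0; exact: span_nil.
by under eq_fun do rewrite linearD linearZ; exact: span_cons.
Qed.

Lemma span_sum (V : lmodType R) S (I : Type) (r : seq I) (f : I -> T -> V) :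
  (forall i, span S (f i)) -> span S (fun x => \sum_(i <- r) f i x).
Proof.
move=> Sf; elim: r => [|i r IH].
  by under eq_fun do rewrite big_nil; exact: span_nil.
by under eq_fun do rewrite big_cons; exact: span_add.
Qed.

Lemma span_scale S a (f : T -> R^o) : span S f -> span S (fun x => a * f x : R^o).
Proof. exact: (span_linear (GRing.scale a : {linear R^o -> R^o})). Qed.

Lemma span_gen S (s : T -> R) : S s -> span S (s : T -> R^o).
Proof.
move=> Ss; have := span_cons (1 : R^o) Ss (span_nil _).
by under eq_fun do rewrite addr0 /GRing.scale /= mulr1.
Qed.

Lemma span_scalev (V : lmodType R) S (f : T -> R^o) (v : V) :
  span S f -> span S (fun x => (f x : R) *: v).
Proof.
elim=> [|s a h Ss _ IH]; first by under eq_fun do rewrite scale0r; exact: span_nil.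
by under eq_fun do rewrite scalerDl -scalerA; exact: span_cons.
Qed.

Definition approx X S (f : T -> R) : Prop :=
  forall e, 0 < e ->
    exists2 g : T -> R^o, span S g & forall x, X x -> `|f x - g x| <= e.

Lemma span_approx X S (f : T -> R^o) : span S f -> approx X S f.
Proof. by move=> Sf e e0; exists f => // x _; rewrite subrr normr0 ltW. Qed.

Lemma approx_lim X S f :
  (forall e, 0 < e -> exists2 g, approx X S g & forall x, X x -> `|f x - g x| <= e) ->
  approx X S f.
Proof.
move=> fP e e0; have e20 : 0 < e / 2 by rewrite divr_gt0.
have [g /(_ _ e20)[h Sh gh] fg] := fP _ e20.
exists h => // x Xx; rewrite [e]splitr (le_trans (ler_distD (g x) _ _)) //.
by rewrite lerD ?fg ?gh.
Qed.

Lemma approx_add X S f g :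
  approx X S f -> approx X S g -> approx X S (fun x => f x + g x).
Proof.
move=> fP gP e e0; have e20 : 0 < e / 2 by rewrite divr_gt0.
have [f' Sf' ff'] := fP _ e20; have [g' Sg' gg'] := gP _ e20.
exists (fun x => f' x + g' x); first exact: span_add.
move=> x Xx; rewrite [e]splitr opprD addrACA (le_trans (ler_normD _ _)) //.
by rewrite lerD ?ff' ?gg'.
Qed.

Lemma approx_scale X S a f : approx X S f -> approx X S (fun x => a * f x).
Proof.
move=> fP e e0; have a1 : 0 < 1 + `|a| by rewrite ltr_pwDl.
have [g Sg fg] := fP (e / (1 + `|a|)) (divr_gt0 e0 a1).
exists (fun x => a * g x); first exact: span_scale.
move=> x Xx; rewrite -mulrBr normrM.
rewrite (le_trans (ler_wpM2l (normr_ge0 a) (fg x Xx))) // mulrCA ler_piMr ?(ltW e0) //.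
by rewrite ltW // ltr_pdivrMr // mul1r ltrDr.
Qed.

Lemma approx_sum X S (I : Type) (r : seq I) (f : I -> T -> R) :
  (forall i, approx X S (f i)) -> approx X S (fun x => \sum_(i <- r) f i x).
Proof.
move=> Sf; elim: r => [|i r IH].
  by under eq_fun do rewrite big_nil; exact/span_approx/span_nil.
by under eq_fun do rewrite big_cons; exact: approx_add.
Qed.

Lemma approx_span X S1 S2 (f : T -> R^o) :
  (forall s, S1 s -> approx X S2 s) -> span S1 f -> approx X S2 f.
Proof.
move=> S12; elim=> [|s a h Ss _ IH]; first exact/span_approx/span_nil.
apply: approx_add => //; under eq_fun do rewrite /GRing.scale /= mulrC.
exact/approx_scale/S12.
Qed.

Lemma approx_trans X S1 S2 f :
  (forall s, S1 s -> approx X S2 s) -> approx X S1 f -> approx X S2 f.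
Proof.
move=> S12 fP; apply: approx_lim => e /fP[g Sg fg].
by exists g => //; exact: approx_span Sg.
Qed.

(** Approximants found separately for each coordinate are merged into one vector-valued span
    element, hence into a single hidden layer. *)
Lemma approx_cV X S (K : nat) (f : T -> 'cV[R]_K) :
  (forall i, approx X S (fun x => f x i 0)) ->
  forall e, 0 < e -> exists2 g : T -> 'cV[R]_K,
    span S g & forall x i, X x -> `|f x i 0 - g x i 0| <= e.
Proof.
move=> fP e e0.
have /choice[g gP] : forall i, exists g : T -> R^o,
    span S g /\ forall x, X x -> `|f x i 0 - g x| <= e.
  by move=> i; have [g] := fP i _ e0; exists g.
exists (fun x => \sum_i (g i x : R) *: delta_mx i 0).
  by apply: span_sum => i; apply: span_scalev; case: (gP i).
move=> x i Xx; rewrite summxE (bigD1 i) //= big1 => [|j ji].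
  by rewrite !mxE !eqxx mulr1 addr0; apply: (gP i).2.
by rewrite !mxE eq_sym (negPf ji) mulr0.
Qed.

End Span.

Section Ridge.
Context {R : realType} {p : nat}.

Definition ridge (s : R -> R) : set ('cV[R]_p -> R) :=
  [set h | exists (w : 'rV[R]_p) (b : R), h = fun x => s ((w *m x) 0 0 + b)].

(** Each term of the span becomes a hidden neuron: a column of [A], a row of [B] and an entry of
    [c]. Surplus neurons get output weight zero, which allows every larger width. *)
Lemma network_of_span (s : R -> R) (K : nat) (f : 'cV[R]_p -> 'cV[R]_K) :
  span (ridge s) f ->
  exists T0 : nat, forall T, (T0 <= T)%N ->
  exists (A : 'M[R]_(K, T)) (B : 'M[R]_(T, p)) (c : 'cV[R]_T),
  forall x, f x = A *m vsigma s (B *m x + c).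
Proof.
elim=> [|_ v g [w [b ->]] _ [T0 IH]].
  by exists 0%N => T _; exists 0, 0, 0 => x; rewrite mul0mx.
exists T0.+1 => -[//|T] /IH[A [B [c gE]]].
rewrite -[T.+1]add1n.
exists (row_mx v A : 'M[R]_(K, 1 + T)), (col_mx w B : 'M[R]_(1 + T, p)).
exists (col_mx b%:M c : 'cV[R]_(1 + T)) => x.
rewrite mul_col_mx add_col_mx /vsigma map_col_mx mul_row_col gE; congr (_ + _).
apply/colP => i; rewrite !mxE big_ord1 mulrC !mxE.
by rewrite mulr1n.
Qed.

End Ridge.

(** * Staircase approximation of the exponential *)

Section Staircase.
Context {R : realType}.
Implicit Types (s st : R -> R).

Lemma monotone_normalize s (C a b : R) :
  s a != s b -> (forall x, `|s x| <= C) -> {homo s : x y / x <= y} ->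
  exists lo d : R, [/\ 0 < d, forall t, 0 <= (s t - lo) / d <= 1 &
    forall e, 0 < e -> exists2 L, 0 < L &
      (forall t, L <= t -> 1 - e <= (s t - lo) / d) /\
      (forall t, t <= - L -> (s t - lo) / d <= e)].
Proof.
move=> sab sC smono.
have rs0 : range s !=set0 by exists (s 0); exists 0.
have hs : has_sup (range s).
  by split=> //; exists C => _ [x _ <-]; exact: le_trans (ler_norm _) (sC x).
have hi : has_inf (range s).
  split=> //; exists (- C) => _ [x _ <-].
  by rewrite lerNl (le_trans _ (sC x)) // -normrN ler_norm.
have lo_s t : inf (range s) <= s t by apply: (ge_inf hi.2); exists t.
have s_hi t : s t <= sup (range s) by apply: (ub_le_sup hs.2); exists t.
set lo := inf _ in lo_s; set up := sup _ in s_hi.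
have d0 : 0 < up - lo.
  rewrite subr_gt0 lt_neqAle (le_trans (lo_s 0) (s_hi 0)) andbT.
  apply: contra sab => /eqP lu.
  by rewrite eq_le !(le_trans (s_hi _)) // -?lu lo_s.
exists lo, (up - lo); split=> // [t|e e0].
  by rewrite ler_pdivlMr // mul0r ler_pdivrMr // mul1r lerD2r subr_ge0 lo_s s_hi.
have ed0 : 0 < e * (up - lo) by rewrite mulr_gt0.
have [_ [x _ <-] xP] := sup_adherent ed0 hs.
have [_ [y _ <-] yP] := inf_adherent ed0 hi.
(* Beyond the near-maximizer [x] and the near-minimizer [y], monotonicity keeps [s] near its
   supremum and infimum. *)
exists (1 + `|x| + `|y|); first by rewrite -addrA ltr_pwDl // addr_ge0.
split=> t tL.
  rewrite ler_pdivlMr // mulrBl mul1r lerBrDr addrAC subrK.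
  apply: (le_trans (ltW xP)); apply: smono; apply: le_trans tL.
  rewrite (le_trans (ler_norm _)) // -addrA addrCA lerDl addr_ge0 //.
rewrite ler_pdivrMr // lerBlDl (le_trans _ (ltW yP)) //; apply: smono.
apply: (le_trans tL); rewrite lerNl.
by rewrite (le_trans (ler_norm _)) // normrN lerDr addr_ge0.
Qed.

Lemma locate_step (u : nat -> R) n t : u 0%N <= t <= u n.+1 ->
  exists2 j, (j <= n)%N & u j <= t <= u j.+1.
Proof.
elim: n => [|n IHn] /andP[u0t tu]; first by exists 0%N; rewrite ?u0t.
have [tn|nt] := leP t (u n.+1); last by exists n.+1; rewrite ?(ltW nt).
by have [|j jn jP] := IHn; [rewrite u0t|exists j; rewrite // leqW].
Qed.

(** The graph of [expR] lies above its tangent at [y]. *)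
Lemma expR_increment_le (x y : R) : expR y - expR x <= expR y * (y - x).
Proof.
have -> : expR x = expR y * expR (x - y) by rewrite -expRD addrC subrK.
rewrite -[X in X - _]mulr1 -mulrBr ler_pM2l ?expR_gt0 //.
by have := expR_ge1Dx (x - y); lra.
Qed.

(* The staircase is monotone in [t], as is [expR], so it suffices to compare
   them at the nodes [t_j]; there every step function is far from its own
   threshold, which sits halfway between two nodes. *)
Lemma expR_staircase st :
  {homo st : x y / x <= y} -> (forall t, 0 <= st t <= 1) ->
  (forall e, 0 < e -> exists2 L, 0 < L &
    (forall t, L <= t -> 1 - e <= st t) /\ (forall t, t <= - L -> st t <= e)) ->
  forall L e : R, 0 < L -> 0 < e ->
  exists (n : nat) (lam c0 : R) (c m : 'I_n -> R),
    forall t, - L <= t <= L ->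
      `|expR t - (c0 + \sum_k c k * st (lam * t + m k))| <= e.
Proof.
move=> smono s01 stail L e L0 e0.
have eL0 := expR_gt0 L.
(* Enough nodes for [expR] to grow by at most [e / 2] between neighbours. *)
pose n := (Num.truncn (expR L * (2 * L) / (e / 2))).+1.
have n0 : 0 < n%:R :> R by rewrite ltr0n.
pose h := 2 * L / n%:R.
have h0 : 0 < h by rewrite divr_gt0 // mulr_gt0.
have hn : h * n%:R = 2 * L by rewrite /h divfK ?gt_eqF.
have eh : expR L * h <= e / 2.
  rewrite /h mulrA ler_pdivrMr // [leRHS]mulrC -ler_pdivrMr ?divr_gt0 //.
  by rewrite ltW // truncnS_gt.
(* The jumps [c k] add up to less than [expR L], so an error [d] in each step costs at most [e / 2]
   in total. *)
pose d := e / 2 / expR L.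
have d0 : 0 < d by rewrite !divr_gt0.
have [B B0 [Bhi Blo]] := stail _ d0.
(* Every node is at least [h / 2] from every threshold, a distance that [lam] stretches to [B],
   where the tail bounds apply. *)
pose lam := 2 * B / h.
have lam0 : 0 < lam by rewrite divr_gt0 // mulr_gt0.
have lamh : lam * h = 2 * B by rewrite /lam divfK ?gt_eqF.
pose u (k : nat) : R := - L + k%:R * h.
have uS k : u k.+1 = u k + h by rewrite /u -natr1; ring.
have u_le i j : (i <= j)%N -> u i <= u j.
  by move=> ij; rewrite lerD2l ler_pM2r // ler_nat.
have u0 : u 0%N = - L by rewrite /u mul0r addr0.
have un : u n = L by rewrite /u mulrC hn; ring.
pose c (k : nat) := expR (u k.+1) - expR (u k).
have c0 k : 0 <= c k by rewrite subr_ge0 ler_expR u_le.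
have sumc j : \sum_(k < j) c k = expR (u j) - expR (u 0%N).
  by rewrite -(big_mkord xpredT c) telescope_sumr.
exists n, lam, (expR (- L)), (fun k => c k), (fun k => - (lam * (u k + h / 2))).
pose N t := expR (- L) + \sum_(k < n) c k * st (lam * t + - (lam * (u k + h / 2))).
have N_mono t t' : t <= t' -> N t <= N t'.
  move=> tt'; rewrite lerD2l ler_sum // => k _; rewrite ler_wpM2l //.
  by apply: smono; rewrite lerD2r ler_pM2l.
have N_node j : (j <= n)%N -> `|expR (u j) - N (u j)| <= e / 2.
  move=> jn.
  have -> : expR (u j) - N (u j) = \sum_(k < n)
      c k * ((k < j)%N%:R - st (lam * u j + - (lam * (u k + h / 2)))).
    under eq_bigr do rewrite mulrBr.
    rewrite sumrB /N opprD addrA -u0 -sumc; congr (_ - _).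
    rewrite (big_ord_widen _ c jn) big_mkcond; apply: eq_bigr => k _.
    by case: ifP; rewrite ?mulr1 ?mulr0.
  apply: (le_trans (ler_norm_sum _ _ _)).
  apply: (@le_trans _ _ (\sum_(k < n) c k * d)).
    apply: ler_sum => k _; rewrite normrM ger0_norm // ler_wpM2l //.
    set z := lam * _ + _; have /andP[z0 z1] := s01 z.
    have zE : z = lam * (u j - u k) - B.
      by rewrite /z; lra.
    have [kj|jk] := ltnP k j.
      have Bz : B <= z.
        have : lam * h <= lam * (u j - u k).
          by rewrite ler_pM2l // lerBrDl -uS u_le.
        by rewrite zE lamh; lra.
      by have := Bhi _ Bz; rewrite mulr1n ger0_norm ?subr_ge0 //; lra.
    have zB : z <= - B.
      have : lam * (u j - u k) <= 0 by rewrite pmulr_rle0 // subr_le0 u_le.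
      by rewrite zE; lra.
    by rewrite mulr0n sub0r normrN ger0_norm // Blo.
  rewrite -big_distrl /= sumc un /d mulrCA ler_piMr ?divr_ge0 ?ltW //.
  by rewrite ltr_pdivrMr // mul1r gtrBl expR_gt0.
(* Between two nodes both functions are squeezed by their node values: [e / 2] from the node error
   and [e / 2] from the growth of [expR]. *)
move=> t tL; have /locate_step[j jn /andP[jt tj]] : u 0%N <= t <= u n.
  by rewrite u0 un.
have := N_node j (leqW jn); have := N_node j.+1 jn.
have := N_mono _ _ jt; have := N_mono _ _ tj; rewrite -/(N t).
have : expR (u j) <= expR t by rewrite ler_expR.
have : expR t <= expR (u j.+1) by rewrite ler_expR.
have : expR (u j.+1) - expR (u j) <= e / 2.
  apply: (le_trans (expR_increment_le _ _)); apply: le_trans eh.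
  by rewrite uS [u j + h - _]addrC addKr ler_pM2r // ler_expR -un -uS u_le.
by rewrite !ler_norml => ? ? ? ? ? /andP[? ?] /andP[? ?]; apply/andP; split; lra.
Qed.

End Staircase.

(** * Ridge exponentials and the algebra they span *)

Section RidgeExp.
Context {R : realType} {p : nat}.
Implicit Types (s : R -> R) (M : R).

(** The network has no output bias; a neuron with zero input weights supplies the constants. *)
Lemma span_ridge_cst s (t c : R) : s t != 0 ->
  span (@ridge R p s) (fun=> c : R^o).
Proof.
move=> st0.
have -> : (fun=> c) = (fun x : 'cV[R]_p => c / s t * s (((0 : 'rV[R]_p) *m x) 0 0 + t)).
  by apply/funext => x; rewrite mul0mx mxE add0r divfK.
by apply: span_scale; apply: span_gen; exists 0, t.
Qed.

Lemma approx_ridge_expR s (C a b M : R) (w : 'rV[R]_p) :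
  s a != s b -> (forall x, `|s x| <= C) -> {homo s : x y / x <= y} ->
  approx (cube p M) (ridge s) (fun x => expR ((w *m x) 0 0)).
Proof.
move=> sab sC smono.
have cst c : approx (cube p M) (ridge s) (fun=> c).
  have [sa0|sa0] := eqVneq (s a) 0; last by apply: span_approx; exact: span_ridge_cst sa0.
  by apply: span_approx; apply: (@span_ridge_cst _ b); rewrite -sa0 eq_sym.
have [lo [d [d0 s01 stail]]] := monotone_normalize sab sC smono.
(* A bound for the linear form on the cube; the added 1 makes it positive. *)
pose L := 1 + \sum_i `|w 0 i| * `|M|.
have L0 : 0 < L by rewrite ltr_pwDl // sumr_ge0 // => i _; rewrite mulr_ge0.
have wL x : cube p M x -> - L <= (w *m x) 0 0 <= L.
  move=> xM; rewrite -ler_norml mxE ler_wpDl //.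
  apply: (le_trans (ler_norm_sum _ _ _)); apply: ler_sum => i _.
  rewrite normrM ler_wpM2l //.
  by have := xM i; rewrite -ler_norml => /le_trans -> //; exact: ler_norm.
apply: approx_lim => e e0.
have stmono : {homo (fun t => (s t - lo) / d) : x y / x <= y}.
  by move=> x y xy; rewrite ler_pM2r ?invr_gt0 // lerD2r smono.
have [n [lam [c0 [c [m H]]]]] := expR_staircase stmono s01 stail L0 e0.
exists (fun x => c0 + \sum_k c k * ((s (lam * (w *m x) 0 0 + m k) - lo) / d)).
  2: by move=> x /wL; exact: H.
apply: approx_add; first exact: cst.
apply: approx_sum => k; apply: approx_scale.
under eq_fun do rewrite mulrC.
apply: approx_scale; apply: approx_add; last exact: cst.
apply: span_approx; apply: span_gen.
exists (lam *: w), (m k); apply/funext => x.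
by rewrite -scalemxAl [in RHS]mxE.
Qed.

Lemma approx_admissible_expR s M (w : 'rV[R]_p) : admissible_activation s ->
  approx (cube p M) (ridge s) (fun x => expR ((w *m x) 0 0)).
Proof.
case=> [->|[[a [b sab]] _ [C sC] smono]]; last exact: approx_ridge_expR sab sC smono.
pose ramp (t : R) := relu (t + 1) - relu t.
apply: (@approx_trans _ _ _ (ridge ramp)); last first.
  apply: (@approx_ridge_expR ramp 1 (- 1) 0).
  - have -> : ramp (- 1) = 0 by rewrite /ramp /relu !maxEle; do 2 case: ifP; lra.
    have -> : ramp 0 = 1 by rewrite /ramp /relu !maxEle; do 2 case: ifP; lra.
    by rewrite eq_sym oner_neq0.
  - by move=> t; rewrite ler_norml /ramp /relu !maxEle; do 2 case: ifP; lra.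
  - by move=> t t'; rewrite /ramp /relu !maxEle; do 4 case: ifP; lra.
move=> _ [v [b ->]]; rewrite /ramp; apply: approx_add.
  by apply: span_approx; apply: span_gen; exists v, (b + 1); apply/funext => x; rewrite addrA.
under eq_fun do rewrite -mulN1r.
by apply/approx_scale/span_approx/span_gen; exists v, b.
Qed.

Definition exp_ridge : set ('cV[R]_p -> R) :=
  [set h | exists w : 'rV[R]_p, h = fun x => expR ((w *m x) 0 0)].

Lemma span_exp_cst (c : R) : span exp_ridge (fun=> c : R^o).
Proof.
have -> : (fun=> c) = (fun x : 'cV[R]_p => c * expR (((0 : 'rV[R]_p) *m x) 0 0)).
  by apply/funext => x; rewrite mul0mx mxE expR0 mulr1.
by apply: span_scale; apply: span_gen; exists 0.
Qed.

(** Exponents add under multiplication, so the span is an algebra and contains all polynomials in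
    the [expR (x i 0)]. *)
Lemma span_exp_mul (f g : 'cV[R]_p -> R^o) :
  span exp_ridge f -> span exp_ridge g ->
  span exp_ridge (fun x => (f x : R) * g x : R^o).
Proof.
move=> Sf Sg; elim: Sf => [|_ a h [w ->] _ IH].
  by under eq_fun do rewrite mul0r; exact: span_nil.
under eq_fun do rewrite mulrDl; apply: span_add => // {IH h}.
under eq_fun do rewrite /GRing.scale /= mulrAC mulrC.
apply: span_scale; elim: Sg => [|_ b h [v ->] _ IH].
  by under eq_fun do rewrite mulr0; exact: span_nil.
have expD x : expR (((w + v) *m x) 0 0) =
    expR ((w *m x) 0 0) * expR ((v *m x) 0 0) :> R.
  by rewrite mulmxDl [in LHS]mxE expRD.
under eq_fun do rewrite mulrDr mulrA -expD.
by apply: span_cons => //; exists (w + v).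
Qed.

Lemma span_exp_prod (I : Type) (r : seq I) (f : I -> 'cV[R]_p -> R^o) :
  (forall i, span exp_ridge (f i)) ->
  span exp_ridge (fun x => \prod_(i <- r) (f i x : R) : R^o).
Proof.
move=> Sf; elim: r => [|i r IH].
  by under eq_fun do rewrite big_nil; exact: span_exp_cst.
by under eq_fun do rewrite big_cons; exact: span_exp_mul.
Qed.

Lemma span_exp_pow (f : 'cV[R]_p -> R^o) (n : nat) : span exp_ridge f ->
  span exp_ridge (fun x => (f x : R) ^+ n : R^o).
Proof.
move=> Sf; elim: n => [|n IH].
  by under eq_fun do rewrite expr0; exact: span_exp_cst.
by under eq_fun do rewrite exprS; exact: span_exp_mul.
Qed.

End RidgeExp.

(** * The exponential coordinate on an interval *)

Section ExpCoordinate.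
Context {R : realType}.
Variable M : R.
Hypothesis M_gt0 : 0 < M.

(* Rescaled so that it maps [-M, M] onto [0, 1]; its powers are again
   exponentials, which makes the Bernstein basis a span of exponentials. *)
Definition ecoord (y : R) : R := (expR y - expR (- M)) / (expR M - expR (- M)).

Let width_gt0 : 0 < expR M - expR (- M).
Proof. by rewrite subr_gt0 ltr_expR gtrN. Qed.

Lemma ecoord_itv y : - M <= y <= M -> 0 <= ecoord y <= 1.
Proof.
move=> /andP[y1 y2]; rewrite /ecoord ler_pdivlMr // mul0r ler_pdivrMr // mul1r.
by rewrite lerD2r subr_ge0 !ler_expR y1.
Qed.

Lemma ecoord_surj z : 0 <= z <= 1 -> exists2 y, - M <= y <= M & ecoord y = z.
Proof.
move=> /andP[z0 z1]; pose v := expR (- M) + z * (expR M - expR (- M)).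
have v0 : 0 < v by rewrite ltr_wpDr ?expR_gt0 // mulr_ge0 // ltW.
have lnvK : expR (ln v) = v by rewrite lnK ?posrE.
exists (ln v); last by rewrite /ecoord lnvK /v addrC addKr mulfK ?gt_eqF.
rewrite -ler_expR -[X in _ && X]ler_expR lnvK /v lerDl mulr_ge0 ?(ltW width_gt0) //=.
by rewrite -lerBrDl ler_piMl // ltW.
Qed.

(** On [[-M, M]] the slope of [expR] is at least [expR (- M)]. Points far apart thus stay far apart
    in the new coordinate; squares are taken to match the Bernstein variance. *)
Lemma ecoord_expansion : exists2 kappa : R, 0 < kappa &
  forall y y', - M <= y <= M -> - M <= y' <= M ->
    kappa * (y - y') ^+ 2 <= (ecoord y - ecoord y') ^+ 2.
Proof.
pose k := expR (- M) / (expR M - expR (- M)).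
have k0 : 0 < k by rewrite divr_gt0 ?expR_gt0.
exists (k ^+ 2) => [|y y' yM y'M]; first exact: exprn_gt0.
wlog yy' : y y' yM y'M / y' <= y => [H|].
  have [yy'|/ltW yy'] := leP y' y; first exact: H.
  by rewrite -(opprB y') sqrrN -(opprB (ecoord y')) sqrrN; exact: H.
have -> : ecoord y - ecoord y' = (expR y - expR y') / (expR M - expR (- M)).
  by rewrite /ecoord -mulrBl opprB addrA subrK.
have yy'0 : 0 <= k * (y - y') by rewrite mulr_ge0 ?subr_ge0 // ltW.
rewrite -exprMn.
suff lin : k * (y - y') <= (expR y - expR y') / (expR M - expR (- M)).
  by rewrite lerXn2r // nnegrE // (le_trans yy'0).
rewrite /k mulrAC ler_pM2r ?invr_gt0 //.
have := expR_ge1Dx (y - y').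
have -> : expR y = expR y' * expR (y - y') by rewrite -expRD addrC subrK.
have : expR (- M) <= expR y' by rewrite ler_expR; case/andP: y'M.
have := expR_gt0 y'; have := expR_gt0 (- M); nra.
Qed.

End ExpCoordinate.

Lemma span_exp_mbernstein (R : realType) (p n : nat) (M : R)
    (k : {ffun 'I_p -> 'I_n.+1}) :
  span exp_ridge
    (fun x : 'cV[R]_p => mbernstein (fun i => ecoord M (x i 0)) k : R^o).
Proof.
have Sc i : span exp_ridge (fun x : 'cV[R]_p => ecoord M (x i 0) : R^o).
  rewrite /ecoord; under eq_fun do rewrite mulrC.
  apply: span_scale; apply: span_add; last exact: span_exp_cst.
  apply: span_gen; exists (delta_mx 0 i); apply/funext => x.
  by rewrite -rowE mxE.
apply: span_exp_prod => i; rewrite /bernstein.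
apply: span_exp_mul; last apply: span_exp_pow.
  by apply: span_exp_mul; [exact: span_exp_cst|exact: span_exp_pow].
apply: span_add; first exact: span_exp_cst.
by under eq_fun do rewrite -mulN1r; exact: span_scale.
Qed.

(** * Kernels on the cube *)

Section Compactness.
Context {R : realType}.

Lemma cube_compact (p : nat) (M : R) : compact (cube p M).
Proof.
have -> : cube p M = trmx @` [set v : 'rV[R]_p | forall i, `[- M, M]%classic (v 0 i)].
  apply/seteqP; split=> [x xM|_ [v vM <-] i]; last first.
    by have := vM i; rewrite /= in_itv mxE.
  exists x^T; last exact: trmxK.
  by move=> i; rewrite /= in_itv /= mxE; exact: xM.
apply: continuous_compact; last first.
  by apply: (@rV_compact _ _ (fun=> `[- M, M]%classic)) => i; exact: segment_compact.
apply: continuous_subspaceT => v A /nbhs_ballP[e /= e0 eA].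
apply/nbhs_ballP; exists e => //= y [_ vy].
by apply: eA; split=> // i j; rewrite !mxE; exact: vy.
Qed.

Lemma compact_unif_continuous (X : pseudoMetricType R) (K : set X) (f : X -> R) :
  compact K -> {within K, continuous f} -> forall e, 0 < e ->
  exists2 d, 0 < d &
    forall x y, K x -> K y -> ball x d y -> `|f x - f y| < e.
Proof.
move=> /compact_near_coveringP Kc fc e e0.
have := Kc _ 0^'+ (fun d x => K x -> forall y, K y -> ball x d y -> `|f x - f y| < e).
case=> [x Kx|d /= d0 H].
- have /subspace_continuousP/(_ x Kx)/cvgrPdist_lt/(_ (e / 2)) := fc.
  rewrite divr_gt0 // => /(_ isT); rewrite near_withinE.
  case/nbhs_ballP => r /= r0 rP.
  (* Heine-Cantor: [z] is within [r / 2] of [x] and [y] within [d <= r / 2] of [z], so both are in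
     the ball of radius [r] where [f] is [e / 2]-close to [f x]. The near-covering property makes
     [d] uniform. *)
  near=> z d => /= Kz y Ky zy.
  have xz : ball x (r / 2) z.
    by near: z; apply: nbhsx_ballx; rewrite divr_gt0.
  have dr : d <= r / 2 by near: d; apply: nbhs_right_le; rewrite divr_gt0.
  have xy : ball x r y.
    by rewrite [r]splitr; apply: ball_triangle xz (le_ball dr zy).
  have xz' : ball x r z by apply: le_ball xz; rewrite ler_pdivrMr // ler_peMr ?ltW // ltr1n.
  have := rP _ xz' Kz; have := rP _ xy Ky => fy fz.
  rewrite [e]splitr (le_lt_trans (ler_distD (f x) _ _)) // ltrD //.
  by rewrite distrC.
- exists (d / 2); first by rewrite divr_gt0.
  move=> x y Kx Ky; apply: (H (d / 2)) => //; last by rewrite divr_gt0.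
  by rewrite /ball_ /= sub0r normrN gtr0_norm ?divr_gt0 // ltr_pdivrMr // ltr_pMr // ltr1n.
Unshelve. all: by end_near.
Qed.

Lemma compact_bounded_fun (X : topologicalType) (K : set X) (f : X -> R) :
  compact K -> {within K, continuous f} ->
  exists2 C, 0 <= C & forall x, K x -> `|f x| <= C.
Proof.
move=> Kc fc; have /compact_bounded[B [_ HB]] := continuous_compact fc Kc.
exists (`|B| + 1); first by rewrite addr_ge0.
move=> x Kx; apply: (HB (`|B| + 1)); last by exists x.
by rewrite (le_lt_trans (ler_norm _)) // ltrDl.
Qed.

(* Points at distance less than the modulus of continuity contribute the first
   term; for the others the squared distance is bounded below. *)
Lemma continuity_quadratic_bound (p : nat) (M : R) (h : 'cV[R]_p * 'cV[R]_p -> R) :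
  0 < M -> {within cube p M `*` cube p M, continuous h} ->
  forall e, 0 < e -> exists2 C, 0 <= C &
    forall x x' y y', cube p M x -> cube p M x' -> cube p M y -> cube p M y' ->
    `|h (x, x') - h (y, y')| <= e +
      C * (\sum_i (ecoord M (x i 0) - ecoord M (y i 0)) ^+ 2 +
           \sum_i (ecoord M (x' i 0) - ecoord M (y' i 0)) ^+ 2).
Proof.
move=> M0 hc e e0.
have Kc : compact (cube p M `*` cube p M) by apply: compact_setX; exact: cube_compact.
have [d d0 dP] := compact_unif_continuous Kc hc e0.
have [B B0 BP] := compact_bounded_fun Kc hc.
have [k k0 kP] := ecoord_expansion M0.
have kd0 : 0 < k * d ^+ 2 by rewrite mulr_gt0 // exprn_gt0.
(* Once one pair is at distance at least [d], the second term alone reaches [2 * B], which bounds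
   any difference of values of [h]. *)
exists (2 * B / (k * d ^+ 2)); first by rewrite divr_ge0 ?mulr_ge0 // ltW.
move=> x x' y y' xM x'M yM y'M.
pose D (u v : 'cV[R]_p) := \sum_i (ecoord M (u i 0) - ecoord M (v i 0)) ^+ 2.
rewrite -/(D x y) -/(D x' y').
have D0 u v : 0 <= D u v by apply: sumr_ge0 => i _; exact: sqr_ge0.
have far u v : cube p M u -> cube p M v -> ~ ball u d v -> k * d ^+ 2 <= D u v.
  move=> uM vM /not_andP[//|/existsNP[i /existsNP[j]]].
  rewrite (ord1 j) /ball /= => /negP; rewrite -leNgt => duv.
  rewrite /D (bigD1 i) //= ler_wpDr //; first by apply: sumr_ge0 => l _; exact: sqr_ge0.
  apply: le_trans (kP _ _ (uM i) (vM i)); rewrite ler_pM2l //.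
  by rewrite -[leRHS]real_normK ?num_real // lerXn2r ?nnegrE ?normr_ge0 // ltW.
have large : k * d ^+ 2 <= D x y + D x' y' ->
    `|h (x, x') - h (y, y')| <= e + 2 * B / (k * d ^+ 2) * (D x y + D x' y').
  move=> kD; apply: (@le_trans _ _ (2 * B)).
    rewrite (le_trans (ler_normB _ _)) // mulr_natl mulr2n.
    by rewrite lerD // BP.
  rewrite ler_wpDl ?(ltW e0) // mulrAC ler_pdivlMr // ler_wpM2l // mulr_ge0 //.
have [bx|/far bx] := pselect (ball x d y); last first.
  by apply: large; rewrite ler_wpDr // bx.
have [bx'|/far bx'] := pselect (ball x' d y'); last first.
  by apply: large; rewrite ler_wpDl // bx'.
rewrite ler_wpDr //; first by rewrite !mulr_ge0 ?addr_ge0 // invr_ge0 ltW.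
by apply/ltW/dP.
Qed.

End Compactness.

(** The quadratic bound is averaged against the weights [w k x * w l x'], of total mass 1. Each
    averaged squared distance is a sum of [p] Bernstein variances, at most [p / (n + 1)]. *)
Lemma bernstein_kernel_approx (R : realType) (p : nat) (M : R)
    (h : 'cV[R]_p * 'cV[R]_p -> R) :
  0 < M -> {within cube p M `*` cube p M, continuous h} ->
  forall e, 0 < e -> exists (N : nat) (w : 'I_N -> 'cV[R]_p -> R^o) (y : 'I_N -> 'cV[R]_p),
  [/\ forall k, span exp_ridge (w k), forall k, cube p M (y k),
      forall k x, cube p M x -> 0 <= w k x,
      forall x, \sum_k (w k x : R) = 1 &
      forall x x', cube p M x -> cube p M x' ->
        `|h (x, x') - \sum_k \sum_l (w k x : R) * w l x' * h (y k, y l)| <= e].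
Proof.
move=> M0 hc e e0; have e20 : 0 < e / 2 by rewrite divr_gt0.
have [C C0 hC] := continuity_quadratic_bound M0 hc e20.
(* Makes [C * 2p / (n + 1)] at most [e / 2]. *)
pose n := Num.truncn (C * (p%:R + p%:R) / (e / 2)).
pose I : finType := {ffun 'I_p -> 'I_n.+2}.
have /choice[eta etaP] (j : 'I_n.+2) :
    exists z, - M <= z <= M /\ ecoord M z = j%:R / n.+1%:R.
  have [|z] := @ecoord_surj _ _ M0 (j%:R / n.+1%:R); last by exists z.
  by rewrite divr_ge0 ?ler0n //= ler_pdivrMr ?ltr0n // mul1r ler_nat -ltnS.
pose y (k : I) : 'cV[R]_p := \col_i eta (k i).
pose w (k : I) (x : 'cV[R]_p) : R := mbernstein (fun i => ecoord M (x i 0)) k.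
have yM k : cube p M (y k) by move=> i; rewrite mxE; case: (etaP (k i)).
have x01 x : cube p M x -> forall i, 0 <= ecoord M (x i 0) <= 1.
  by move=> xM i; apply: ecoord_itv.
have w0 k x : cube p M x -> 0 <= w k x by move=> /x01; exact: mbernstein_ge0.
have w1 x : \sum_k w k x = 1 by exact: mbernstein_sum1.
pose D (x : 'cV[R]_p) (k : I) := \sum_i (ecoord M (x i 0) - ecoord M (y k i 0)) ^+ 2.
have wD x : cube p M x -> \sum_k w k x * D x k <= p%:R / n.+1%:R.
  move=> xM; under eq_bigr do rewrite mulr_sumr.
  rewrite exchange_big /= mulr_natl -[p in leRHS]card_ord -sumr_const.
  apply: ler_sum => i _.
  rewrite (eq_bigr (fun k => w k x * (ecoord M (x i 0) - (k i)%:R / n.+1%:R) ^+ 2)).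
    exact: (@mbernstein_variance _ _ n _ i (x01 _ xM)).
  by move=> k _; rewrite mxE (etaP _).2.
have hD x x' k l : cube p M x -> cube p M x' ->
    `|h (x, x') - h (y k, y l)| <= e / 2 + C * (D x k + D x' l).
  by move=> xM x'M; exact: hC.
clearbody D.
have main x x' : cube p M x -> cube p M x' ->
    `|h (x, x') - \sum_k \sum_l w k x * w l x' * h (y k, y l)| <= e.
  move=> xM x'M.
  have dbl (a : R) : a = \sum_k \sum_l w k x * w l x' * a.
    under eq_bigr do rewrite -mulr_suml -mulr_sumr w1 mulr1.
    by rewrite -mulr_suml w1 mul1r.
  rewrite {1}(dbl (h _)) -sumrB.
  under eq_bigr do rewrite -sumrB.
  apply: (@le_trans _ _
      (\sum_k \sum_l w k x * w l x' * (e / 2 + C * (D x k + D x' l)))).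
    apply: (le_trans (ler_norm_sum _ _ _)); apply: ler_sum => k _.
    apply: (le_trans (ler_norm_sum _ _ _)); apply: ler_sum => l _.
    rewrite -mulrBr normrM ger0_norm ?mulr_ge0 ?w0 // ler_wpM2l ?mulr_ge0 ?w0 //.
    exact: hD.
  have -> : \sum_k \sum_l w k x * w l x' * (e / 2 + C * (D x k + D x' l)) =
      e / 2 + C * (\sum_k w k x * D x k + \sum_l w l x' * D x' l).
    under eq_bigr do under eq_bigr do rewrite mulrDr.
    under eq_bigr do rewrite big_split /=.
    rewrite big_split /= -dbl; congr (_ + _).
    have -> : \sum_l w l x' * D x' l = \sum_k w k x * \sum_l w l x' * D x' l.
      by rewrite -mulr_suml w1 mul1r.
    rewrite -[X in C * X]big_split mulr_sumr; apply: eq_bigr => k _ /=.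
    have -> : w k x * D x k = \sum_l w l x' * (w k x * D x k).
      by rewrite -mulr_suml w1 mul1r.
    rewrite mulr_sumr -[X in C * X]big_split mulr_sumr; apply: eq_bigr => l _ /=; ring.
  rewrite [leRHS]splitr lerD2l.
  apply: (le_trans (ler_wpM2l C0 (lerD (wD _ xM) (wD _ x'M)))).
  rewrite -mulrDl mulrA ler_pdivrMr ?ltr0n // [leRHS]mulrC -ler_pdivrMr //.
  by rewrite ltW // truncnS_gt.
have reI (F : I -> R) : \sum_k F k = \sum_(k < #|I|) F (enum_val k).
  by rewrite (reindex _ (onW_bij _ (@enum_val_bij I))).
exists #|I|, (fun k => w (enum_val k)), (fun k => y (enum_val k)); split=> //.
- by move=> k; exact: span_exp_mbernstein.
- by move=> k x; exact: w0.
- by move=> x; rewrite -(reI (fun k => w k x)).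
move=> x x' xM x'M; have := main x x' xM x'M.
congr (`|_ - _| <= e); rewrite reI; apply: eq_bigr => k _; exact: reI.
Qed.

(** * Conditionally positive definite kernels *)

Section ConditionallyPositive.
Context {R : realType} {q : nat}.
Variables (Y : set 'cV[R]_q) (g : 'cV[R]_q -> 'cV[R]_q -> R).
Hypothesis gsym : forall y y', Y y -> Y y' -> g y y' = g y' y.
Hypothesis gcpd : is_CPD Y g.

(** If [g] were an inner product of features, this would be the Gram matrix of the features
    translated so that [y0] goes to the origin. *)
Definition centered_gram (N : nat) (y : 'I_N -> 'cV[R]_q) (y0 : 'cV[R]_q) : 'M[R]_N :=
  \matrix_(k, l) (g (y k) (y l) - g (y k) y0 - g y0 (y l) + g y0 y0).

(* Conditional positivity is applied to [y0, y_1, ..., y_N], the weight of [y0]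
   being minus the sum of the others. *)
Lemma centered_gram_psd N (y : 'I_N -> 'cV[R]_q) y0 :
  Y y0 -> (forall k, Y (y k)) ->
  forall v : 'cV[R]_N, 0 <= (v^T *m centered_gram y y0 *m v) 0 0.
Proof.
move=> Yy0 Yy v; pose S := \sum_k v k 0.
pose z (i : 'I_N.+1) := oapp y y0 (unlift ord0 i).
pose c (i : 'I_N.+1) := oapp (fun k => v k 0) (- S) (unlift ord0 i).
have z0 : z ord0 = y0 by rewrite /z unlift_none.
have c0 : c ord0 = - S by rewrite /c unlift_none.
have zl k : z (lift ord0 k) = y k by rewrite /z liftK.
have cl k : c (lift ord0 k) = v k 0 by rewrite /c liftK.
have := gcpd (y := z) (c := c).
have zY i : Y (z i) by rewrite /z; case: unlift => [k|] /=.
have sc : \sum_i c i = 0.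
  by rewrite big_ord_recl c0; under eq_bigr do rewrite cl; rewrite addNr.
move=> /(_ zY sc); congr (0 <= _).
have row0 : \sum_j c ord0 * c j * g (z ord0) (z j) =
    - S * - S * g y0 y0 + \sum_l - S * v l 0 * g y0 (y l).
  by rewrite big_ord_recl c0 z0; congr (_ + _); apply: eq_bigr => l _; rewrite cl zl.
have rowS k : \sum_j c (lift ord0 k) * c j * g (z (lift ord0 k)) (z j) =
    v k 0 * - S * g (y k) y0 + \sum_l v k 0 * v l 0 * g (y k) (y l).
  rewrite big_ord_recl c0 z0 cl zl; congr (_ + _).
  by apply: eq_bigr => l _; rewrite cl zl.
rewrite big_ord_recl row0 (eq_bigr _ (fun k _ => rowS k)) big_split /=.
have -> : (v^T *m centered_gram y y0 *m v) 0 0 =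
    \sum_k \sum_l v k 0 * centered_gram y y0 k l * v l 0.
  rewrite mxE exchange_big; apply: eq_bigr => l _.
  by rewrite mxE mulr_suml; apply: eq_bigr => k _; rewrite mxE.
under [RHS]eq_bigr do under eq_bigr do rewrite mxE.
have -> : \sum_k \sum_l v k 0 * (g (y k) (y l) - g (y k) y0 - g y0 (y l) + g y0 y0) * v l 0
  = \sum_k \sum_l v k 0 * v l 0 * g (y k) (y l) +
    \sum_k \sum_l v l 0 * (- (v k 0 * g (y k) y0)) +
    \sum_k \sum_l v k 0 * (- (v l 0 * g y0 (y l))) +
    \sum_k \sum_l v k 0 * (v l 0 * g y0 y0).
  by rewrite -!big_split; apply: eq_bigr => k _; rewrite -!big_split;
     apply: eq_bigr => l _ /=; ring.
have -> : \sum_k \sum_l v l 0 * (- (v k 0 * g (y k) y0)) =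
    \sum_k S * - (v k 0 * g (y k) y0).
  by apply: eq_bigr => k _; rewrite -mulr_suml.
have -> : \sum_k \sum_l v k 0 * (- (v l 0 * g y0 (y l))) =
    S * \sum_l - (v l 0 * g y0 (y l)).
  by rewrite mulr_suml; apply: eq_bigr => k _; rewrite mulr_sumr.
have -> : \sum_k \sum_l v k 0 * (v l 0 * g y0 y0) = S * (S * g y0 y0).
  rewrite [RHS]mulr_suml; apply: eq_bigr => k _.
  by rewrite -mulr_sumr -mulr_suml.
have -> : \sum_k S * - (v k 0 * g (y k) y0) = \sum_k v k 0 * - S * g (y k) y0.
  by apply: eq_bigr => k _; ring.
have -> : S * \sum_k - (v k 0 * g y0 (y k)) = \sum_k - S * v k 0 * g y0 (y k).
  by rewrite mulr_sumr; apply: eq_bigr => k _; ring.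
ring.
Qed.

Lemma centered_gram_sym N (y : 'I_N -> 'cV[R]_q) y0 :
  Y y0 -> (forall k, Y (y k)) -> (centered_gram y y0)^T = centered_gram y y0.
Proof.
move=> Yy0 Yy; apply/matrixP => k l; rewrite !mxE.
by rewrite (gsym (Yy l) (Yy k)) (gsym (Yy l) Yy0) (gsym Yy0 (Yy k)); ring.
Qed.

(** As [a] and [b] have total mass 1, a term in one index alone can be spread over both. The
    identity then holds entry by entry, with the constant [g y0 y0] halved between the two
    potentials. *)
Lemma gram_decomposition N K (y : 'I_N -> 'cV[R]_q) y0 (B : 'M[R]_(N, K))
    (a b : 'I_N -> R) :
  Y y0 -> (forall k, Y (y k)) -> centered_gram y y0 = B *m B^T ->
  \sum_k a k = 1 -> \sum_k b k = 1 ->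
  \sum_k \sum_l a k * b l * g (y k) (y l) =
  \sum_i (\sum_k a k * B k i) * (\sum_k b k * B k i) +
  \sum_k a k * (g (y k) y0 - g y0 y0 / 2) +
  \sum_k b k * (g (y k) y0 - g y0 y0 / 2).
Proof.
move=> Yy0 Yy GE a1 b1.
pose v k := g (y k) y0 - g y0 y0 / 2.
rewrite -/(v _); under [X in _ = _ + X + _]eq_bigr do rewrite -/(v _).
under [X in _ = _ + X]eq_bigr do rewrite -/(v _).
have -> : \sum_k a k * v k = \sum_k \sum_l a k * b l * v k.
  apply: eq_bigr => k _; rewrite -mulr_suml -mulr_sumr b1 mulr1 //.
have -> : \sum_k b k * v k = \sum_k \sum_l a k * b l * v l.
  under [RHS]eq_bigr do under eq_bigr do rewrite -mulrA.
  under [RHS]eq_bigr do rewrite -mulr_sumr.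
  by rewrite -mulr_suml a1 mul1r.
have -> : \sum_i (\sum_k a k * B k i) * (\sum_k b k * B k i) =
    \sum_k \sum_l a k * b l * centered_gram y y0 k l.
  under eq_bigr do rewrite mulr_suml.
  rewrite exchange_big /=; apply: eq_bigr => k _.
  under eq_bigr do rewrite mulr_sumr.
  rewrite exchange_big /=; apply: eq_bigr => l _.
  rewrite GE mxE mulr_sumr; apply: eq_bigr => i _; rewrite mxE; ring.
rewrite -!big_split; apply: eq_bigr => k _; rewrite -!big_split.
by apply: eq_bigr => l _ /=; rewrite mxE /v (gsym Yy0 (Yy l)); field.
Qed.

End ConditionallyPositive.

(** * Error propagation and assembly of the networks *)

Lemma inner_perturbation (R : realDomainType) (K : nat) (C d : R)
    (a b a' b' : 'cV[R]_K) :
  (forall i, `|a i 0| <= C) -> (forall i, `|b i 0| <= C) -> 0 <= d <= 1 ->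
  (forall i, `|a i 0 - a' i 0| <= d) -> (forall i, `|b i 0 - b' i 0| <= d) ->
  `|inner a b - inner a' b'| <= K%:R * ((2 * C + 1) * d).
Proof.
move=> aC bC /andP[d0 d1] aa' bb'; rewrite /inner -sumrB.
apply: (le_trans (ler_norm_sum _ _ _)).
rewrite mulr_natl -[K in leRHS]card_ord -sumr_const; apply: ler_sum => i _.
(* Only the errors and the bounded vectors [a], [b] appear; [d <= 1] makes the quadratic term linear
   in [d]. *)
have -> : a i 0 * b i 0 - a' i 0 * b' i 0 =
  (a i 0 - a' i 0) * b i 0 + a i 0 * (b i 0 - b' i 0)
   - (a i 0 - a' i 0) * (b i 0 - b' i 0) by ring.
apply: (le_trans (ler_normB _ _)).
have -> : (2 * C + 1) * d = d * C + C * d + d * 1 by ring.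
rewrite lerD //; first apply: (le_trans (ler_normD _ _)); rewrite ?lerD //.
- by rewrite normrM ler_pM.
- by rewrite normrM ler_pM.
- by rewrite normrM ler_pM // (le_trans (bb' i)).
Qed.

Lemma continuous_pullback (X Z : topologicalType) (R : realType) (A : set X)
    (Y : set Z) (f : X -> Z) (g : Z -> Z -> R) :
  {within A, continuous f} -> (forall x, A x -> Y (f x)) ->
  {within [set z | Y z.1 /\ Y z.2], continuous (fun z => g z.1 z.2)} ->
  {within A `*` A, continuous (fun z => g (f z.1) (f z.2))}.
Proof.
move=> /subspace_continuousP fc AY /subspace_continuousP gc.
apply/subspace_continuousP => -[x x'] /= [Ax Ax'] P /= Pg.
have [[U V] /= [nU nV] UV] := gc (f x, f x') (conj (AY _ Ax) (AY _ Ax')) _ Pg.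
exists ([set z | A z -> U (f z)], [set z | A z -> V (f z)]).
  by split; [exact: fc nU | exact: fc nV].
move=> [z z'] /= [zU z'V] [Az Az'].
apply: (UV (f z, f z')); first by split=> /=; [exact: zU|exact: z'V].
by split; exact: AY.
Qed.

Theorem theorem4p1 (R : realType) (Kstar : nat) (M : R) (p : nat)
    (Y : set 'cV[R]_Kstar) (fstar : 'cV[R]_p -> 'cV[R]_Kstar)
    (gstar : 'cV[R]_Kstar -> 'cV[R]_Kstar -> R) (sigma : R -> R) :
  0 < M ->
  closed Y ->
  {within cube p M, continuous fstar} ->
  (forall x, cube p M x -> Y (fstar x)) ->
  is_kernel Y gstar ->
  is_CPD Y gstar ->
  admissible_activation sigma ->
  forall eps : R, 0 < eps ->
  exists (K0 T'0 : nat), forall K : nat, (K0 <= K)%N ->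
  exists T0 : nat, forall T T' : nat, (T0 <= T)%N -> (T'0 <= T')%N ->
  exists (A : 'M[R]_(K, T)) (B : 'M[R]_(T, p)) (c : 'cV[R]_T)
         (e : 'cV[R]_T') (F : 'M[R]_(T', p)) (o : 'cV[R]_T'),
    forall x x' : 'cV[R]_p, cube p M x -> cube p M x' ->
      let fpsi := fun z : 'cV[R]_p => A *m vsigma sigma (B *m z + c) in
      let uxi := fun z : 'cV[R]_p => inner e (vsigma sigma (F *m z + o)) in
      `| gstar (fstar x) (fstar x')
         - (inner (fpsi x) (fpsi x') + uxi x + uxi x') | < eps.
Proof.
move=> M0 _ fc fY [gsym gc] gcpd sact e e0.
have e40 : 0 < e / 4 by rewrite divr_gt0.
have hc := continuous_pullback fc fY gc.
have [N [w [y [wspan yM w0 w1 hw]]]] := bernstein_kernel_approx M0 hc e40.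
(* The image of the origin serves as base point. *)
have zero_cube : cube p M 0.
  by move=> i; rewrite mxE lerNl oppr0 (ltW M0).
pose Y0 := fstar 0; have YY0 : Y Y0 by exact: fY.
have Yy k : Y (fstar (y k)) by exact/fY.
pose u x := \sum_k (w k x : R) * (gstar (fstar (y k)) Y0 - gstar Y0 Y0 / 2).
have wapprox k : approx (cube p M) (ridge sigma) (w k).
  by apply: approx_span (wspan k) => _ [v ->]; exact: approx_admissible_expR.
have combination (c : 'I_N -> R) :
    approx (cube p M) (ridge sigma) (fun x => \sum_k (w k x : R) * c k).
  apply: approx_sum => k; under eq_fun do rewrite mulrC.
  exact: approx_scale.
have e80 : 0 < e / 8 by rewrite divr_gt0.
(* The scalar [u] is treated as a column of height 1, so that the vector-valued lemmas also build
   its network. *)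
have u_approx i :
    approx (cube p M) (ridge sigma) (fun x => (const_mx (u x) : 'cV_1) i 0).
  by under eq_fun do rewrite mxE; exact: combination.
have [un un_span unP] := approx_cV u_approx e80.
have [T'0 uT] := network_of_span un_span.
(* [K] must reach the number [N] of sample points for the Gram factor to fit; the network for [u] is
   fixed before [K]. *)
exists N, T'0 => K NK.
have [B GE] := psd_factor_pad NK
  (centered_gram_sym gsym YY0 Yy) (centered_gram_psd gcpd YY0 Yy).
pose phi x : 'cV[R]_K := \col_i \sum_k (w k x : R) * B k i.
pose C := \sum_k \sum_i `|B k i|.
have C0 : 0 <= C by apply: sumr_ge0 => k _; apply: sumr_ge0.
have w_le1 k x : cube p M x -> w k x <= 1.
  move=> xM; rewrite -(w1 x) (bigD1 k) //= lerDl sumr_ge0 // => l _.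
  exact: w0.
have phiC x : cube p M x -> forall i, `|phi x i 0| <= C.
  move=> xM i; rewrite mxE (le_trans (ler_norm_sum _ _ _)) //.
  apply: ler_sum => k _; rewrite normrM (bigD1 i) //= ler_wpDr ?sumr_ge0 //.
  by rewrite ler_piMl // ger0_norm ?w0 ?w_le1.
(* The constant of [inner_perturbation], plus 1 to allow division when [K = 0]. It depends on [K],
   and so does [T0]. *)
pose D := 1 + K%:R * (2 * C + 1).
have D1 : 1 <= D by rewrite lerDl mulr_ge0 ?ler0n // addr_ge0 // mulr_ge0.
have D0 : 0 < D by apply: lt_le_trans D1.
pose d := Num.min 1 (e / 4 / D).
have d0 : 0 < d by rewrite lt_min ltr01 divr_gt0.
have d1 : 0 <= d <= 1 by rewrite ltW //= ge_min lexx.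
have Dd : K%:R * ((2 * C + 1) * d) <= e / 4.
  have : D * d <= e / 4 by rewrite mulrC -ler_pdivlMr // ge_min lexx orbT.
  by apply: le_trans; rewrite mulrA ler_wpM2r ?(ltW d0) // lerDr.
have phi_approx i : approx (cube p M) (ridge sigma) (fun x => phi x i 0).
  by under eq_fun do rewrite mxE; exact: combination.
have [fn fn_span fnP] := approx_cV phi_approx d0.
have [T0 fT] := network_of_span fn_span.
exists T0 => T T' /fT[A [Bm [c fnE]]] /uT[A' [F [b unE]]].
exists A, Bm, c, A'^T, F, b => x x' xM x'M.
have uxiE z : inner A'^T (vsigma sigma (F *m z + b)) = un z 0 0.
  by rewrite unE mxE; apply: eq_bigr => j _; rewrite mxE.
rewrite /= -!fnE !uxiE.
have := hw _ _ xM x'M; rewrite /=.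
rewrite (gram_decomposition gsym YY0 Yy GE (w1 x) (w1 x')) -/(u x) -/(u x').
have -> : \sum_i (\sum_k (w k x : R) * B k i) * (\sum_k (w k x' : R) * B k i) =
    inner (phi x) (phi x').
  by apply: eq_bigr => i _; rewrite !mxE.
have := le_trans (inner_perturbation (phiC _ xM) (phiC _ x'M) d1
  (fun i => fnP x i xM) (fun i => fnP x' i x'M)) Dd.
have := unP x 0 xM; have := unP x' 0 x'M; rewrite !mxE.
move: (inner (phi x) _) (inner (fn x) _) (u x) (u x') (un x 0 0) (un x' 0 0)
  (gstar _ _) => a a' q q' r r' g0.
(* Error budget: [e / 4] for the discretization, [e / 4] for the inner product and [e / 8] for each
   [u], in all [3e / 4 < e]. *)
rewrite !ler_norml ltr_norml => /andP[? ?] /andP[? ?] /andP[? ?] /andP[? ?].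
by apply/andP; split; lra.
Qed.
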